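(* Let $\mathbb{F}\in\{\mathbb{R},\mathbb{C}\}$, $d=2$, $n\ge1$, let $a_{k,2}\in\mathbb{F}$ ($2\le k\le n$), and let $L_0,\dots,L_n\in\mathbb{F}[x_1,x_2]$ be defined by $L_0=1$, $L_1=x_1$ and, for $2\le k\le n$, $$L_k=\Psi_1(L_{k-1})+\Psi_2\Big(\Big(\sum_{t=2}^{k-1}a_{t,2}L_{k-t}\Big)_{i_1=0}\Big)+a_{k,2}x_2.$$ Let $\mathbf{z}_0\in\mathbb{F}^2$ and define $\mathbf{z}_0(h)=\mathbf{z}_0$, $\mathbf{z}_1(h)=\mathbf{z}_0+(h,0)$, and $$\mathbf{z}_i(h)=\mathbf{z}_0+\Big(ih,\ \sum_{j=2}^{i}i(i-1)\cdots(i-j+1)\,a_{j,2}h^j\Big),\qquad i=2,\dots,n.$$ With $A^{(m)}_k=(-1)^{m-k}\frac{1}{k!(m-k)!}$, for every function $f$ analytic at $\mathbf{z}_0$ and every $m=0,\dots,n$, $$(L_m(D)f)(\mathbf{z}_0)=\lim_{h\to0}\frac{1}{h^m}\sum_{i=0}^mA^{(m)}_i f(\mathbf{z}_i(h));$$ i.e. $\mathrm{span}\{\delta_{\mathbf{z}_0}\circ L_0(D),\dots,\delta_{\mathbf{z}_0}\circ L_n(D)\}=\lim_{h\to0}\mathrm{span}\{\delta_{\mathbf{z}_i(h)}:i=0,\dots,n\}$.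
   Context: $\Psi_j$ is the linear operator with $\Psi_j(x_1^{\alpha_1}x_2^{\alpha_2})=\frac{1}{\alpha_j+1}x_1^{\alpha_1}\cdots x_j^{\alpha_j+1}\cdots$ (raising the exponent of $x_j$ by one and dividing by the new exponent); $(M)_{i_1=0}$ is the sum of the terms of $M$ not containing $x_1$. For $p=\sum c_\alpha\mathbf{x}^\alpha$, $p(D)=\sum c_\alpha\partial^{|\alpha|}/\partial x_1^{\alpha_1}\partial x_2^{\alpha_2}$; $\delta_{\mathbf z}$ is evaluation at $\mathbf z$, and the limit of spans is understood via the pointwise limit formula. *)

(* Defs.v *)
(* F is a numFieldType (instantiated with
   R : realType and with the complex numbers complex R = R[i]). *)
From HB Require Import structures.
From mathcomp Require Import all_boot all_order all_algebra.
From mathcomp Require Import all_classical all_reals all_analysis.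
From mathcomp Require Export complex.
Set Implicit Arguments. Unset Strict Implicit. Unset Printing Implicit Defensive.
Import Order.TTheory GRing.Theory Num.Theory.
Import numFieldNormedType.Exports.
Local Open Scope ring_scope.
Local Open Scope classical_set_scope.

Section Defs.
Variable F : numFieldType.

(* Bivariate polynomials F[x1,x2] as {poly {poly F}}: the outer variable is x1 (bx1),
   the inner one is x2 (bx2); coefficient of x1^i x2^j of p is (p`_i)`_j. *)
Local Notation bipoly := {poly {poly F}}.
Definition bx1 : bipoly := 'X.
Definition bx2 : bipoly := ('X)%:P.
Definition bcst (c : F) : bipoly := c%:P%:P.

Definition psi_uni (q : {poly F}) : {poly F} :=
  \poly_(j < (size q).+1) (if j is j'.+1 then (j%:R)^-1 * q`_j' else 0).

Definition Psi1 (p : bipoly) : bipoly :=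
  \poly_(i < (size p).+1) (if i is i'.+1 then (i%:R)^-1 *: p`_i' else 0).

Definition Psi2 (p : bipoly) : bipoly :=
  \poly_(i < size p) psi_uni p`_i.

Definition restr0 (M : bipoly) : bipoly := (M`_0)%:P.

Definition D1 (f : F -> F -> F) : F -> F -> F :=
  fun x y => derive1 (fun t => f t y) x.
Definition D2 (f : F -> F -> F) : F -> F -> F :=
  fun x y => derive1 (fun t => f x t) y.

Definition pD (p : bipoly) (f : F -> F -> F) (x y : F) : F :=
  \sum_(i < size p) \sum_(j < size p`_i)
     p`_i`_j * iter i D1 (iter j D2 f) x y.

(* f is analytic at (z1,z2): locally equal to an absolutely convergent
   power series centered at (z1,z2) (terms grouped by total degree). *)
Definition ps_term (c : nat -> nat -> F) (u v : F) (k i : nat) : F :=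
  c i (k - i)%N * u ^+ i * v ^+ (k - i).
Definition analytic_at (f : F -> F -> F) (z1 z2 : F) : Prop :=
  exists (c : nat -> nat -> F) (r : F), 0 < r /\
    forall x y, `|x - z1| < r -> `|y - z2| < r ->
      cvg ((fun N => \sum_(k < N) \sum_(i < k.+1)
                        `|ps_term c (x - z1) (y - z2) k i|) @ \oo) /\
      (fun N => \sum_(k < N) \sum_(i < k.+1) ps_term c (x - z1) (y - z2) k i)
        @ \oo --> f x y.

Definition znode1 (z01 : F) (i : nat) (h : F) : F := z01 + i%:R * h.
Definition znode2 (a : nat -> F) (z02 : F) (i : nat) (h : F) : F :=
  z02 + \sum_(2 <= j < i.+1) (i ^_ j)%:R * a j * h ^+ j.

Definition Acoef (m k : nat) : F :=
  (-1) ^+ (m - k) / ((k`!)%:R * ((m - k)`!)%:R).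

End Defs.

Notation bipoly F := {poly {poly F}}.

(* Main.v *)
(* In terms of generating functions, the recursion says that sum_m L_m t^m is
   exp (x1 t + x2 A(t)), where A(t) = sum_(j >= 2) a_j t^j.  On the other side,
   the coefficient of h^s in a monomial (z_i(h) - z_0)^(p, q) is a polynomial in
   i of degree at most s, since i^_j has degree j, and the weights A^(m)_i annihilate
   polynomials of degree less than m and extract the coefficient of i^m. Hence
   only s = m survives in the limit, and it contributes the coefficient of t^m in
   t^p A(t)^q, which is p! q! times the coefficient of x1^p x2^q in L_m.  The
   terms of total degree more than m in the expansion of f contribute
   O(h^(m+1)). *)
Require Import Defs.
From HB Require Import structures.
From mathcomp Require Import all_boot all_order all_algebra.
From mathcomp Require Import all_classical all_reals all_analysis.
From mathcomp Require Import complex.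
From mathcomp Require Import ring zify.
Import Order.TTheory GRing.Theory Num.Theory.
Import numFieldNormedType.Exports.
Local Open Scope classical_set_scope.
Local Open Scope ring_scope.
Set Implicit Arguments.
Unset Strict Implicit.

(** * Finite differences along the nodes *)

(** Substituting the monic linear polynomial ['X + 1] preserves both degree and leading coefficient;
    if the degree of [p] is below [m], both sides vanish. *)
Lemma coef_comp_XD1 (F : fieldType) (p : {poly F}) m :
  (size p <= m.+1)%N -> (p \Po ('X + 1))`_m = p`_m.
Proof.
have s2 : size ('X + 1 : {poly F}) = 2%N by rewrite -polyC1 size_XaddC.
have l1 : lead_coef ('X + 1 : {poly F}) = 1.
  by rewrite /lead_coef s2 coefD coefX coef1 addr0.
rewrite leq_eqVlt => /orP[/eqP sp|].
  have sc : size (p \Po ('X + 1)) = m.+1 by rewrite size_comp_poly2.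
  have := @lead_coef_comp _ p ('X + 1); rewrite s2 l1 expr1n mulr1.
  by rewrite /lead_coef sc sp /=; apply.
rewrite ltnS => sp; rewrite [RHS]nth_default// nth_default//.
by rewrite size_comp_poly2.
Qed.

Section Algebra.
Variable F : numFieldType.

Let fact_neq0 k : (k`!)%:R != 0 :> F.
Proof. by rewrite pnatr_eq0 -lt0n fact_gt0. Qed.

(** This is the binomial expansion of [(-1 + 1) ^+ m.+1], divided by [(m+1)!]. *)
Lemma Acoef_sum1 m : \sum_(i < m.+2) Acoef F m.+1 i = 0.
Proof.
have := @exprDn F (-1) 1 m.+1; rewrite addNr expr0n /= => /esym.
move=> /(congr1 (fun x => x / (m.+1)`!%:R)); rewrite mul0r mulr_suml => E.
rewrite -[RHS]E; apply: eq_bigr => i _.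
rewrite /Acoef expr1n mulr1 -[_ *+ 'C(_, _)]mulr_natr -mulrA; congr (_ * _).
rewrite -(bin_fact (ltn_ord i : (i <= m.+1)%N)) 2!natrM.
have cn0 : 'C(m.+1, i)%:R != 0 :> F by rewrite pnatr_eq0 -lt0n bin_gt0 -ltnS.
by rewrite [in RHS]invfM mulVKf.
Qed.

(** Induction on [m], writing [q = r * 'X + c]. The weights of positive order sum to zero and so
    kill [c]; the factor [i] lowers their order by one, which leaves the statement for [r]
    translated by 1, with the same top coefficient. *)
Lemma Acoef_sum m (q : {poly F}) : (size q <= m.+1)%N ->
  \sum_(i < m.+1) Acoef F m i * q.[i%:R] = q`_m.
Proof.
elim: m q => [|m IHm] q sq.
  rewrite big_ord1 /Acoef /= expr0 fact0 mulr1 divr1 mul1r.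
  by rewrite horner_coef0.
elim/poly_ind: q sq => [|r c _].
  by rewrite coef0 big1// => i _; rewrite horner0 mulr0.
rewrite size_MXaddC coefD coefMX coefC addr0 /= => sq.
have sr : (size r <= m.+1)%N.
  by move: sq; case: ifP => [/andP[/eqP -> _]|]; rewrite ?size_poly0.
under eq_bigr do rewrite hornerMXaddC mulrDr.
rewrite big_split /= -mulr_suml Acoef_sum1 mul0r addr0.
rewrite big_ord_recl mulr0 mulr0 add0r -(coef_comp_XD1 sr).
rewrite -IHm; last by rewrite size_comp_poly2// -polyC1 size_XaddC.
apply: eq_bigr => i _; rewrite horner_comp !hornerE.
(* (i + 1) A^(m+1)_(i+1) = A^(m)_i *)
rewrite lift0 /= -natr1 mulrAC; congr (_ * _).
rewrite /Acoef subSS factS natrM -(natr1 i).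
have in0 : i%:R + 1 != 0 :> F by rewrite natr1 pnatr_eq0.
by field; rewrite in0 !fact_neq0.
Qed.

(** * Polynomials in the step whose coefficients have controlled degree in the index *)

Lemma coefM_top (p q : {poly F}) j k : (size p <= j.+1)%N -> (size q <= k.+1)%N ->
  (p * q)`_(j + k) = p`_j * q`_k.
Proof.
move=> sp sq; rewrite coefM.
have jk : (j < (j + k).+1)%N by rewrite ltnS leq_addr.
rewrite (bigD1 (Ordinal jk)) //= addKn big1 ?addr0// => i.
rewrite -val_eqE /= neq_ltn => /orP[ij|ij].
  rewrite [q`_ _]nth_default ?mulr0// (leq_trans sq)// ltn_subRL.
  by rewrite ltn_add2r.
by rewrite [p`_ _]nth_default ?mul0r// (leq_trans sp).
Qed.

(* The outer variable stands for the step h, the inner one for the index i of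
   the node. *)
Definition graded (p : {poly {poly F}}) := forall s, (size (p`_s)%R <= s.+1)%N.

Lemma gradedM p q : graded p -> graded q -> graded (p * q).
Proof.
move=> gp gq s; rewrite coefM; apply: (leq_trans (size_sum _ _ _)).
apply/bigmax_leqP => i _; apply: (leq_trans (size_polyMleq _ _)).
have := leq_add (gp i) (gq (s - i)%N); rewrite addSn addnS subnKC -1?ltnS//.
by case: (_ + _)%N.
Qed.

Lemma graded_sum I (r : seq I) (P : pred I) (G : I -> {poly {poly F}}) :
  (forall i, P i -> graded (G i)) -> graded (\sum_(i <- r | P i) G i).
Proof.
move=> gG s; rewrite coef_sum; apply: (leq_trans (size_sum _ _ _)).
by apply: (big_ind (fun x => x <= s.+1)%N) => // [x y|i Pi];
  [rewrite geq_max => -> -> | exact: gG].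
Qed.

Lemma gradedC (c : F) : graded c%:P%:P.
Proof.
by move=> s; rewrite coefC; case: eqP => _; rewrite ?size_poly0// size_polyC;
  case: eqP.
Qed.

Lemma gradedX p k : graded p -> graded (p ^+ k).
Proof.
move=> gp; elim: k => [|k IHk]; last by rewrite exprS; exact: gradedM.
by rewrite expr0 -polyC1 -polyC1; exact: gradedC.
Qed.

(** For graded [p] this is the top part, collecting the coefficients of h^s i^s. Like a leading
    form, it is multiplicative. *)
Definition diag_poly (p : {poly {poly F}}) : {poly F} := \poly_(s < size p) p`_s`_s.

Lemma coef_diag p s : (diag_poly p)`_s = p`_s`_s.
Proof.
by rewrite coef_poly; case: ltnP => // sp; rewrite (nth_default 0 sp) coef0.
Qed.

Lemma diagM p q : graded p -> graded q -> diag_poly (p * q) = diag_poly p * diag_poly q.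
Proof.
move=> gp gq; apply/polyP => s; rewrite coef_diag !coefM coef_sum.
apply: eq_bigr => i _; rewrite !coef_diag.
by rewrite -coefM_top// subnKC// -ltnS.
Qed.

Lemma diagX p k : graded p -> diag_poly (p ^+ k) = diag_poly p ^+ k.
Proof.
move=> gp; elim: k => [|k IHk].
  by apply/polyP => s; rewrite !expr0 coef_diag !coef1; case: s => [|s];
    rewrite ?coef1 ?coef0.
by rewrite !exprS diagM ?IHk//; exact: gradedX.
Qed.

Lemma diag_sum I (r : seq I) (P : pred I) (G : I -> {poly {poly F}}) :
  diag_poly (\sum_(i <- r | P i) G i) = \sum_(i <- r | P i) diag_poly (G i).
Proof.
apply/polyP => s; rewrite coef_diag !coef_sum.
by apply: eq_bigr => i _; rewrite coef_diag.
Qed.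

Lemma diagC (c : F) : diag_poly c%:P%:P = c%:P.
Proof.
apply/polyP => s; rewrite coef_diag !coefC; case: eqP => [->|]; last by rewrite coef0.
by rewrite coefC.
Qed.

(** The weights act on each coefficient of h^s separately. For s < m that coefficient has degree
    below m in the index and is annihilated; for s = m its top coefficient is extracted; the terms
    with s > m only affect [Q] away from 0. *)
Lemma Acoef_sum_graded m (P : {poly {poly F}}) : graded P ->
  exists Q : {poly F}, Q.[0] = (diag_poly P)`_m /\
    forall h, \sum_(i < m.+1) Acoef F m i * P.[h%:P].[i%:R] = h ^+ m * Q.[h].
Proof.
move=> gP.
pose l s := \sum_(i < m.+1) Acoef F m i * (P`_s).[i%:R].
have l0 s : (s < m)%N -> l s = 0.
  move=> sm; rewrite /l Acoef_sum; last first.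
    by rewrite (leq_trans (gP s))// ltnS ltnW.
  by rewrite nth_default// (leq_trans (gP s)).
exists (\poly_(s < size P) l (m + s)%N); split.
  rewrite horner_coef0 coef_poly addn0 coef_diag /l Acoef_sum//.
  case: ltnP => //; rewrite leqn0 size_poly_eq0 => /eqP ->.
  by rewrite !coef0.
move=> h; rewrite horner_poly mulr_sumr.
(* The range is padded to [m + size P] so that exactly the first [m] coefficients, which vanish,
   split off. *)
have -> : \sum_(i < m.+1) Acoef F m i * P.[h%:P].[i%:R] =
          \sum_(s < m + size P) l s * h ^+ s.
  rewrite /l; under [RHS]eq_bigr do rewrite mulr_suml.
  rewrite exchange_big /=; apply: eq_bigr => i _.
  rewrite (horner_coef_wide h%:P (leq_addl m (size P))) horner_sum mulr_sumr.
  by apply: eq_bigr => s _; rewrite -polyC_exp hornerM hornerC mulrA.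
rewrite big_split_ord /= big1 ?add0r => [|s _]; last by rewrite l0// mul0r.
by apply: eq_bigr => s _; rewrite mulrCA -exprD.
Qed.

(** * The nodes as polynomials in the step and the index *)

Definition ffact_poly j : {poly F} := \prod_(l <- iota 0 j) ('X - l%:R%:P).

Lemma size_ffact_poly j : size (ffact_poly j) = j.+1.
Proof. by rewrite /ffact_poly size_prod_XsubC size_iota. Qed.

Lemma coef_ffact_poly j : (ffact_poly j)`_j = 1.
Proof.
have /monicP := monic_prod_XsubC (iota 0 j) predT (fun l => l%:R : F).
by rewrite /lead_coef -/(ffact_poly j) size_ffact_poly.
Qed.

Lemma horner_ffact_poly j i : (ffact_poly j).[i%:R] = (i ^_ j)%:R.
Proof.
elim: j => [|j IHj]; first by rewrite /ffact_poly big_nil hornerC ffactn0.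
rewrite /ffact_poly -addn1 iotaD big_cat big_seq1 addn1 /= add0n hornerM.
rewrite -/(ffact_poly j) IHj ffactnSr natrM.
rewrite !hornerE; have [ji|ij] := leqP j i; first by rewrite natrB.
by rewrite ffact_small// !mul0r.
Qed.

Section Nodes.
Variables (a : nat -> F) (n : nat).

Definition node_poly1 : {poly {poly F}} := 'X%:P * 'X.

(** The sum goes up to [n] for every index, so that one polynomial serves all nodes: at index i the
    terms with j > i vanish because the falling factorial does. *)
Definition node_poly2 : {poly {poly F}} :=
  \sum_(2 <= j < n.+1) (a j *: ffact_poly j)%:P * 'X^j.

(** The series A(t) cut at degree [n]; only coefficients up to [m <= n] of its powers are ever
    read. *)
Definition shift_poly : {poly F} := \sum_(2 <= j < n.+1) a j *: 'X^j.

Lemma coef_shift_poly k :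
  shift_poly`_k = if (2 <= k <= n)%N then a k else 0.
Proof.
rewrite coef_sum; under eq_bigr do rewrite coefZ coefXn.
case: ifP => kn.
  rewrite (bigD1_seq k) ?mem_index_iota ?iota_uniq//= eqxx mulr1.
  by rewrite big1 ?addr0// => i /negbTE ik; rewrite eq_sym ik mulr0.
rewrite big_nat_cond big1// => i /andP[ni _].
case: eqP => [ki|_]; last by rewrite mulr0.
by rewrite ki -ltnS ni in kn.
Qed.

Lemma graded_monomial (q : {poly F}) j : (size q <= j.+1)%N -> graded (q%:P * 'X^j).
Proof.
by move=> sq s; rewrite coefCM coefXn; case: eqP => [->|];
  rewrite ?mulr1// mulr0 size_poly0.
Qed.

Lemma diag_monomial (q : {poly F}) j : diag_poly (q%:P * 'X^j) = q`_j *: 'X^j.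
Proof.
apply/polyP => s; rewrite coef_diag coefCM coefZ !coefXn.
by case: eqP => [->|]; rewrite ?mulr1// !mulr0 coef0.
Qed.

Lemma graded_node1 : graded node_poly1.
Proof. by apply: (@graded_monomial 'X 1); rewrite size_polyX. Qed.

Lemma diag_node1 : diag_poly node_poly1 = 'X.
Proof. by rewrite [LHS](diag_monomial 'X 1) coefX scale1r. Qed.

Lemma graded_node2 : graded node_poly2.
Proof.
apply: graded_sum => j _; apply: graded_monomial.
by rewrite (leq_trans (size_scale_leq _ _))// size_ffact_poly.
Qed.

Lemma diag_node2 : diag_poly node_poly2 = shift_poly.
Proof.
rewrite diag_sum; apply: eq_bigr => j _.
by rewrite diag_monomial coefZ coef_ffact_poly mulr1.
Qed.

Lemma horner_node1 (z h : F) i : node_poly1.[h%:P].[i%:R] = znode1 z i h - z.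
Proof. by rewrite /znode1 addrC addKr !hornerE. Qed.

Lemma horner_node2 (z h : F) i : (i <= n)%N ->
  node_poly2.[h%:P].[i%:R] = znode2 a z i h - z.
Proof.
move=> ni; rewrite /znode2 addrC addKr 2!horner_sum.
have hm j : ((a j *: ffact_poly j)%:P * 'X^j).[h%:P].[i%:R] =
    (i ^_ j)%:R * a j * h ^+ j.
  by rewrite hornerM hornerC hornerXn -polyC_exp hornerM hornerZ hornerC
     horner_ffact_poly (mulrC (a j)).
have hm0 j : (i < j)%N -> ((a j *: ffact_poly j)%:P * 'X^j).[h%:P].[i%:R] = 0.
  by move=> ij; rewrite hm ffact_small// !mul0r.
have [i1|i2] := leqP i 1.
  rewrite [RHS]big_geq// big_nat big1// => j /andP[j2 _].
  by rewrite hm0// (leq_trans _ j2).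
rewrite (big_cat_nat (n := i.+1))//=; last exact: ltnW.
rewrite [X in _ + X]big_nat [X in _ + X]big1 ?addr0.
  by apply: eq_bigr => j _; rewrite hm.
by move=> j /andP[ij _]; rewrite hm0.
Qed.

Definition ps_sum (c : nat -> nat -> F) (N : nat) (u v : F) :=
  \sum_(k < N) \sum_(i < k.+1) ps_term c u v k i.

(** The truncated series evaluated along the nodes is a graded polynomial, so [Acoef_sum_graded]
    applies; passing to the diagonal replaces the two coordinates by t and A(t). *)
Lemma Acoef_sum_ps (c : nat -> nat -> F) m (z1 z2 : F) : (m <= n)%N ->
  exists Q : {poly F},
    Q.[0] = \sum_(k < m.+1) \sum_(i < k.+1)
               c i (k - i)%N * ('X^i * shift_poly ^+ (k - i))`_m /\
    forall h, \sum_(i < m.+1) Acoef F m i *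
      ps_sum c m.+1 (znode1 z1 i h - z1) (znode2 a z2 i h - z2) = h ^+ m * Q.[h].
Proof.
move=> mn.
pose P k i := (c i (k - i)%N)%:P%:P * (node_poly1 ^+ i * node_poly2 ^+ (k - i)).
have gP k i : graded (P k i).
  apply: gradedM; first exact: gradedC.
  by apply: gradedM; apply: gradedX; [exact: graded_node1|exact: graded_node2].
have [|Q [Q0 Qh]] := @Acoef_sum_graded m (\sum_(k < m.+1) \sum_(i < k.+1) P k i).
  by apply: graded_sum => k _; apply: graded_sum => i _.
exists Q; split.
  rewrite Q0 diag_sum coef_sum; apply: eq_bigr => k _.
  rewrite diag_sum coef_sum; apply: eq_bigr => i _.
  have gn1 := gradedX i graded_node1.
  have gn2 := gradedX (k - i) graded_node2.
  rewrite diagM; [|exact: gradedC|exact: gradedM].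
  by rewrite diagC diagM// !diagX ?diag_node1 ?diag_node2 ?coefCM//;
    [exact: graded_node2|exact: graded_node1].
move=> h; rewrite -Qh; apply: eq_bigr => i _; congr (_ * _).
rewrite !horner_sum; apply: eq_bigr => k _; rewrite !horner_sum.
apply: eq_bigr => j _; rewrite !hornerM !hornerC !horner_exp.
rewrite -horner_node1 -horner_node2; last by rewrite (leq_trans _ mn)// -ltnS.
by rewrite /ps_term mulrA.
Qed.

(** * Coefficients of the recursively defined polynomials *)

Lemma coef_Psi1 (p : {poly {poly F}}) i :
  (Psi1 p)`_i = if i is i'.+1 then (i%:R)^-1 *: p`_i' else 0.
Proof.
rewrite coef_poly; case: i => [|i] //; rewrite ltnS.
by case: ltnP => // sp; rewrite nth_default ?scaler0.
Qed.

Lemma coef_Psi2 (p : {poly {poly F}}) i j :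
  (Psi2 p)`_i`_j = if j is j'.+1 then (j%:R)^-1 * p`_i`_j' else 0.
Proof.
rewrite coef_poly; case: ltnP => sp; last first.
  by rewrite coef0 nth_default//; case: j => // j; rewrite coef0 mulr0.
rewrite coef_poly; case: j => [|j] //; rewrite ltnS.
by case: ltnP => // sp'; rewrite [p`_i`_j]nth_default ?mulr0.
Qed.

(** Coefficientwise form of the generating function exp(x1 t + x2 A(t)), by strong induction. [Psi1]
    accounts for a factor t when x1 occurs; otherwise [Psi2] accounts for a factor A(t). *)
Lemma coef_L (L : nat -> {poly {poly F}}) :
  L 0%N = 1 -> L 1%N = bx1 F ->
  (forall k, (2 <= k <= n)%N ->
     L k = Psi1 (L k.-1)
           + Psi2 (restr0 (\sum_(2 <= t < k) bcst (a t) * L (k - t)%N))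
           + bcst (a k) * bx2 F) ->
  forall m i j, (m <= n)%N ->
    (L m)`_i`_j = ('X^i * shift_poly ^+ j)`_m / (i`!%:R * j`!%:R).
Proof.
move=> L0 L1 Lk; have a0 : shift_poly`_0 = 0 by rewrite coef_shift_poly.
elim/ltn_ind => m IHm i j mn.
case: m mn IHm => [|[|m]] mn IHm.
- rewrite L0 coef0M coefXn coef1 eq_sym; case: i => [|i] /=; last first.
    by rewrite !mul0r coef0.
  rewrite mul1r coef1; case: j => [|j] /=; first by rewrite coef1 !fact0 mulr1 divr1.
  by rewrite exprS coef0M a0 !mul0r.
- rewrite L1 /bx1 coefX; case: i => [|[|i]] /=.
  + rewrite mul1r coef0; case: j => [|j]; first by rewrite coef1 mul0r.
    rewrite exprS coefM big_ord_recl big_ord1 /= /bump /= a0 coef_shift_poly /=.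
    by rewrite !mul0r addr0 mul0r.
  + rewrite coefXnM /= coef1; case: j => [|j] /=.
      by rewrite coef1 /= !fact0 mulr1 divr1.
    by rewrite exprS coef0M a0 !mul0r.
  + by rewrite coef0 coefXnM /= mul0r.
rewrite Lk; last by rewrite mn.
rewrite !coefD coef_Psi1 coef_Psi2 /restr0 /bcst /bx2 -rmorphM /=.
(* The [Psi2] term and the term in x2 are free of x1, so a positive exponent of x1 leaves only
   [Psi1]. *)
rewrite ![(_%:P)`_i]coefC; case: i => [|i] /=; last first.
  rewrite coef0 addr0 coefZ IHm//; last exact: ltnW.
  rewrite exprS -mulrA coefXM /= factS natrM.
  rewrite mulrCA -[_ * i`!%:R * _]mulrA [in RHS]invfM.
  by case: j => [|j]; rewrite ?coef0 ?mulr0 addr0.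
rewrite coef0 add0r mul1r coefCM coefX; case: j => [|j] /=.
  by rewrite coef1 mulr0 mul0r addr0.
rewrite fact0 mul1r factS exprS coefM natrM invfM mulrA coef_sum.
rewrite -(big_mkord xpredT (fun t => shift_poly`_t * (shift_poly ^+ j)`_(m.+2 - t))).
(* In the product of A and A^j the indices 0 and 1 contribute nothing. The last index meets the
   constant term of A^j, which is nonzero only for j = 0; it matches the summand
   [bcst (a k) * bx2]. *)
have -> : \sum_(0 <= t < m.+3) shift_poly`_t * (shift_poly ^+ j)`_(m.+2 - t) =
    \sum_(2 <= t < m.+2) a t * (shift_poly ^+ j)`_(m.+2 - t) +
    a m.+2 * (j == 0)%:R.
  rewrite big_nat_recr//= subnn coef_shift_poly mn /=; congr (_ + _).
    rewrite big_ltn// big_ltn// a0 coef_shift_poly !mul0r !add0r.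
    apply: eq_big_nat => t /andP[t2 tm]; rewrite coef_shift_poly t2 /=.
    by rewrite (leq_trans _ mn)// ltnW.
  case: (j) => [|i]; first by rewrite expr0 coef1.
  by rewrite exprS coef0M a0 mul0r.
rewrite eqSS -mulrA -invfM mulrDl -!mulrA; congr (_ + _); last first.
  by case: (j) => [|i] /=;
    [rewrite fact0 !mulr1n !mulr1 divr1 mulr1 | rewrite mulr0n mul0r].
rewrite coef_sum mulr_sumr mulr_suml.
apply: eq_big_nat => t /andP[t2 tm].
rewrite !coefCM IHm//=; last 2 first.
- by rewrite ltn_subrL; case: t t2 {tm}.
- by rewrite (leq_trans (leq_subr _ _)).
by rewrite mul1r fact0 mul1r invfM; ring.
Qed.
End Nodes.
End Algebra.

(** * Analytic functions of two variables *)

(* The only completeness of F that the termwise differentiation of power series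
   needs. *)
Definition geom_complete (F : numFieldType) :=
  forall (t : nat -> F) (M : F), (forall k, `|t k| <= M * 2^-1 ^+ k) ->
  cvg ((fun N => \sum_(k < N) t k) @ \oo).

Section Analysis.
Variable F : numFieldType.
Implicit Types (u v h s rho M : F) (c : nat -> nat -> F).

Lemma cvg_norm_le (x : nat -> F) (l B : F) :
  x @ \oo --> l -> (\forall N \near \oo, `|x N| <= B) -> `|l| <= B.
Proof.
move=> xl xB; apply/ler_addgt0Pr => e e0.
have [N [lN NB]] := @filter_ex _ _ _ _ (filterI (cvgr_dist_lt _ _ xl _ e0) xB).
rewrite -(subrK (x N) l) (le_trans (ler_normD _ _))// addrC lerD//.
exact: ltW.
Qed.

Lemma ler_succ_exp2 k : (k.+1)%:R <= 2 ^+ k :> F.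
Proof. by rewrite -natrX ler_nat ltn_expl. Qed.

Lemma sum_half N : \sum_(k < N) 2^-1 ^+ k <= 2 :> F.
Proof.
suff -> : \sum_(k < N) 2^-1 ^+ k = 2 - 2 * 2^-1 ^+ N :> F.
  by rewrite gerBl mulr_ge0// exprn_ge0// invr_ge0.
elim: N => [|N IHN]; first by rewrite big_ord0 expr0 mulr1 subrr.
by rewrite big_ord_recr /= IHN exprS; field.
Qed.

(** * Estimates for double power series *)

Definition ps_hom c u v k := \sum_(i < k.+1) ps_term c u v k i.

(** There are k + 1 monomials of degree k, and each coefficient is at most [M / rho ^+ k]. *)
Lemma ps_hom_bound c rho M s u v k : 0 < rho ->
  (forall i j, `|c i j| * rho ^+ (i + j) <= M) -> `|u| <= s -> `|v| <= s ->
  `|ps_hom c u v k| <= (k.+1)%:R * (M * (s / rho) ^+ k).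
Proof.
move=> r0 cM us vs; rewrite /ps_hom (le_trans (ler_norm_sum _ _ _))//.
rewrite [leRHS]mulr_natl -[X in _ *+ X](card_ord k.+1) -sumr_const.
apply: ler_sum => i _; rewrite /ps_term !normrM !normrX.
have ik : (i + (k - i) = k)%N by rewrite subnKC// -ltnS.
have s0 : 0 <= s by exact: le_trans us.
have ui : `|u| ^+ i <= s ^+ i by rewrite lerXn2r// nnegrE.
have vi : `|v| ^+ (k - i) <= s ^+ (k - i) by rewrite lerXn2r// nnegrE.
have ci : `|c i (k - i)%N| <= M / rho ^+ k.
  by rewrite ler_pdivlMr ?exprn_gt0// -[X in rho ^+ X]ik.
rewrite exprMn exprVn mulrCA [leRHS]mulrC -[X in s ^+ X]ik exprD mulrA.
by rewrite !ler_pM ?mulr_ge0 ?exprn_ge0.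
Qed.

(** Since k + 1 <= 2^k, the tail is dominated by a geometric series of ratio [2 * (s / rho)]. The
    first [m] factors are kept, to give the order of smallness in [s]; the others are bounded by
    1/2. *)
Lemma ps_tail_bound c rho M s u v m N : 0 < rho ->
  (forall i j, `|c i j| * rho ^+ (i + j) <= M) -> s <= rho / 16 ->
  `|u| <= s -> `|v| <= s -> (m <= N)%N ->
  `|ps_sum c N u v - ps_sum c m u v| <= 2 * M * (2 * (s / rho)) ^+ m.
Proof.
move=> r0 cM sr us vs mN.
have s0 : 0 <= s by exact: le_trans us.
have M0 : 0 <= M by rewrite (le_trans _ (cM 0 0)%N)// mulr_ge0// exprn_ge0// ltW.
have q0 : 0 <= s / rho by rewrite divr_ge0// ltW.
have q2 : 2 * (s / rho) <= 2^-1.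
  rewrite mulrA ler_pdivrMr// mulrC -ler_pdivlMr// (le_trans sr)//.
  rewrite [2^-1 * _]mulrC -mulrA ler_pM2l// -invfM lef_pV2 ?posrE//.
  by rewrite -natrM ler_nat.
rewrite /ps_sum -(subnKC mN) big_split_ord /= addrAC subrr add0r.
rewrite (le_trans (ler_norm_sum _ _ _))//.
apply: (@le_trans _ _ (\sum_(k < N - m) M * (2 * (s / rho)) ^+ m * 2^-1 ^+ k)).
  apply: ler_sum => k _; apply: (le_trans (ps_hom_bound _ r0 cM us vs)).
  rewrite mulrCA -mulrA ler_wpM2l//.
  apply: (@le_trans _ _ ((2 * (s / rho)) ^+ (m + k))).
    by rewrite [leRHS]exprMn ler_wpM2r ?exprn_ge0// ler_succ_exp2.
  rewrite exprD; apply: ler_wpM2l; first by rewrite exprn_ge0// mulr_ge0.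
  by rewrite lerXn2r// nnegrE ?invr_ge0// mulr_ge0.
rewrite -mulr_sumr mulrC -mulrA ler_wpM2r ?sum_half//.
by rewrite mulr_ge0// exprn_ge0// mulr_ge0.
Qed.

(** * Termwise differentiation *)

(** The remainders satisfy R_(j+1) = (v + h) R_j + h^2 j v^(j-1), and j^2 + j <= (j + 1)^2. The
    factor [s ^+ 2] on the left avoids a negative power of [s] on the right. *)
Lemma exp_taylor2 s v h j : `|v| <= s -> `|v + h| <= s ->
  `|(v + h) ^+ j - v ^+ j - h * (j%:R * v ^+ j.-1)| * s ^+ 2
    <= `|h| ^+ 2 * (j%:R ^+ 2 * s ^+ j).
Proof.
move=> vs vhs; have s0 : 0 <= s by exact: le_trans vs.
elim: j => [|j IHj].
  by rewrite !expr0 subrr mul0r mulr0 subrr normr0 mul0r expr0n /= mul0r mulr0.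
have -> : (v + h) ^+ j.+1 - v ^+ j.+1 - h * ((j.+1)%:R * v ^+ j.+1.-1) =
   (v + h) * ((v + h) ^+ j - v ^+ j - h * (j%:R * v ^+ j.-1)) +
   h ^+ 2 * (j%:R * v ^+ j.-1).
  by case: j {IHj} => [|j] /=; rewrite ?expr0 -?natr1 !exprS; ring.
apply: (@le_trans _ _ (s * (`|h| ^+ 2 * (j%:R ^+ 2 * s ^+ j)) +
    `|h| ^+ 2 * (j%:R * s ^+ j.+1))).
  apply: (le_trans (ler_wpM2r _ (ler_normD _ _))); first exact: exprn_ge0.
  rewrite mulrDl lerD//.
    by rewrite normrM -mulrA ler_pM// mulr_ge0// exprn_ge0.
  rewrite !normrM normr_nat normrX -!mulrA ler_wpM2l ?exprn_ge0//.
  rewrite ler_wpM2l//.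
  case: j {IHj} => [|j] /=; first by rewrite !mul0r.
  rewrite ler_wpM2l// -[j.+2]addn2 exprD ler_wpM2r ?exprn_ge0//.
  by rewrite lerXn2r// nnegrE.
rewrite mulrCA -mulrDr ler_wpM2l ?exprn_ge0//.
rewrite mulrCA -exprS -mulrDl ler_wpM2r ?exprn_ge0//.
by rewrite -!natrX -natrD ler_nat -[j.+1]addn1 sqrnD; lia.
Qed.

Definition ps_d2 c : nat -> nat -> F := fun i j => (j.+1)%:R * c i j.+1.

(** Differentiation lowers the total degree by one, so the truncations at [N] and [N.+1]
    correspond. *)
Lemma ps_sum_derive2 c N u v : ps_sum (ps_d2 c) N u v =
  \sum_(k < N.+1) \sum_(i < k.+1)
    c i (k - i)%N * u ^+ i * ((k - i)%:R * v ^+ (k - i).-1).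
Proof.
rewrite big_ord_recl big_ord1 subnn mul0r mulr0 add0r.
apply: eq_bigr => k _; rewrite lift0 [RHS]big_ord_recr /= subnn mul0r mulr0 addr0.
apply: eq_bigr => i _; rewrite /ps_term /ps_d2 subSn -1?ltnS//=.
by ring.
Qed.

(** Summation of [exp_taylor2]. In degree k the squared exponent and the number of monomials give at
    most (k + 1)^3 <= 8^k against 16^-k. The bound does not depend on [N], so it survives the
    limit. *)
Lemma ps_sum_taylor c rho M u v h N : 0 < rho ->
  (forall i j, `|c i j| * rho ^+ (i + j) <= M) ->
  `|u| <= rho / 16 -> `|v| <= rho / 16 -> `|v + h| <= rho / 16 ->
  `|ps_sum c N.+1 u (v + h) - ps_sum c N.+1 u v - h * ps_sum (ps_d2 c) N u v|
     * (rho / 16) ^+ 2 <= `|h| ^+ 2 * (2 * M).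
Proof.
set s := rho / 16 => r0 cM us vs vhs.
have s0 : 0 <= s by exact: le_trans us.
have M0 : 0 <= M by rewrite (le_trans _ (cM 0 0)%N)// mulr_ge0// exprn_ge0// ltW.
have sr : s / rho = 16^-1 by rewrite /s mulrAC mulfV ?mul1r// gt_eqF.
clearbody s.
have -> : ps_sum c N.+1 u (v + h) - ps_sum c N.+1 u v - h * ps_sum (ps_d2 c) N u v =
  \sum_(k < N.+1) \sum_(i < k.+1) c i (k - i)%N * u ^+ i *
     ((v + h) ^+ (k - i) - v ^+ (k - i) - h * ((k - i)%:R * v ^+ (k - i).-1)).
  rewrite ps_sum_derive2 /ps_sum mulr_sumr -!sumrB; apply: eq_bigr => k _.
  rewrite mulr_sumr -!sumrB; apply: eq_bigr => i _.
  by rewrite /ps_term; ring.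
apply: (le_trans (ler_wpM2r (exprn_ge0 _ s0) (ler_norm_sum _ _ _))).
rewrite mulr_suml.
apply: (@le_trans _ _ (\sum_(k < N.+1) `|h| ^+ 2 * M * 2^-1 ^+ k)); last first.
  rewrite -mulr_sumr -mulrA ler_wpM2l ?exprn_ge0// mulrC ler_wpM2r//.
  exact: sum_half.
apply: ler_sum => k _.
apply: (le_trans (ler_wpM2r (exprn_ge0 _ s0) (ler_norm_sum _ _ _))).
rewrite mulr_suml.
apply: (@le_trans _ _ (\sum_(i < k.+1)
    `|h| ^+ 2 * ((k.+1)%:R ^+ 2 * (M * (s / rho) ^+ k)))).
  apply: ler_sum => i _; rewrite !normrM -mulrA.
  apply: (le_trans (ler_wpM2l _ (exp_taylor2 _ vs vhs))); first exact: mulr_ge0.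
  rewrite mulrCA ler_wpM2l ?exprn_ge0// mulrCA ler_pM//.
  - by rewrite !mulr_ge0// exprn_ge0.
  - by rewrite lerXn2r// ?nnegrE// ler_nat (leq_trans (leq_subr _ _)).
  have ik : (i + (k - i) = k)%N by rewrite subnKC// -ltnS.
  apply: (@le_trans _ _ (`|c i (k - i)%N| * s ^+ k)).
    rewrite -mulrA ler_wpM2l// -[X in _ <= s ^+ X]ik exprD.
    by rewrite ler_wpM2r ?exprn_ge0// normrX lerXn2r// nnegrE.
  rewrite exprMn exprVn [leRHS]mulrCA [leRHS]mulrC ler_wpM2r ?exprn_ge0//.
  by rewrite ler_pdivlMr ?exprn_gt0// -[X in rho ^+ X]ik.
rewrite sumr_const card_ord -[leLHS]mulr_natl [leLHS]mulrCA -[leRHS]mulrA.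
rewrite ler_wpM2l ?exprn_ge0//.
rewrite sr [leLHS]mulrA -[_ * _ ^+ 2]exprS mulrCA ler_wpM2l//.
apply: (@le_trans _ _ ((2 ^+ k) ^+ 3 * 16^-1 ^+ k)).
  by rewrite ler_wpM2r ?exprn_ge0 ?invr_ge0// lerXn2r ?nnegrE ?exprn_ge0// ler_succ_exp2.
rewrite exprAC -exprMn (_ : 2 ^+ 3 * 16^-1 = 2^-1)//.
by field.
Qed.

Lemma near_dnbhs0 (d : F) : 0 < d -> \forall h \near (0 : F)^', h != 0 /\ `|h| < d.
Proof.
move=> d0; near=> h; split; near: h; first exact: nbhs_dnbhs_neq.
exact: dnbhs0_lt.
Unshelve. all: by end_near. Qed.

(* The factor 16 leaves room for crude estimates: the quadratic remainder of the
   derivative brings in a factor (k + 1)^3 <= 8^k in degree k. *)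
Definition has_ps (f : F -> F -> F) (z1 z2 : F) c :=
  exists rho M, [/\ 0 < rho, forall i j, `|c i j| * rho ^+ (i + j) <= M &
    forall u v, `|u| < rho / 16 -> `|v| < rho / 16 ->
      (fun N => ps_sum c N u v) @ \oo --> f (z1 + u) (z2 + v)].

Lemma has_ps_center f z1 z2 c : has_ps f z1 z2 c -> f z1 z2 = c 0%N 0%N.
Proof.
move=> [rho [M [r0 _ fE]]].
have s0 : `|0 : F| < rho / 16 by rewrite normr0 divr_gt0.
have := fE _ _ s0 s0; rewrite !addr0 => fz.
apply: (cvg_unique (@norm_hausdorff _ _) fz).
(* The partial sum for [N = 0] is empty; the sequence is constant only from the next index on. *)
rewrite /= -cvg_shiftS; apply: cvg_near_cst; near=> N.
rewrite /= /ps_sum big_ord_recl big_ord1 /ps_term !expr0 subnn !mulr1.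
rewrite big1 ?addr0// => k _; rewrite lift0; apply: big1 => i _.
case: (i : nat) => [|j]; last by rewrite expr0n mulr0 mul0r.
by rewrite subn0 [0 ^+ k.+1]expr0n mulr0.
Unshelve. all: by end_near. Qed.

Hypothesis Fcomplete : geom_complete F.

(** The k + 1 monomials of degree k cost a factor 2^k against 16^-k, so the homogeneous parts decay
    at least like 2^-k and [Fcomplete] applies. *)
Lemma ps_sum_cvg c rho M u v : 0 < rho ->
  (forall i j, `|c i j| * rho ^+ (i + j) <= M) ->
  `|u| <= rho / 16 -> `|v| <= rho / 16 -> cvg ((fun N => ps_sum c N u v) @ \oo).
Proof.
move=> r0 cM us vs.
suff b k : `|ps_hom c u v k| <= M * 2^-1 ^+ k by exact: (Fcomplete b).
have M0 : 0 <= M by rewrite (le_trans _ (cM 0 0)%N)// mulr_ge0// exprn_ge0// ltW.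
rewrite (le_trans (ps_hom_bound _ r0 cM us vs))// mulrCA ler_wpM2l//.
rewrite mulrAC mulfV ?mul1r ?gt_eqF//.
apply: (@le_trans _ _ (2 ^+ k * 16^-1 ^+ k)).
  by rewrite ler_wpM2r ?exprn_ge0 ?invr_ge0// ler_succ_exp2.
rewrite -exprMn lerXn2r ?nnegrE ?mulr_ge0 ?invr_ge0//.
have -> : 2 * 16^-1 = 8^-1 :> F by field.
by rewrite lef_pV2 ?posrE// ler_nat.
Qed.

(** The differentiated series converges to some [g]; letting [N] grow in [ps_sum_taylor] shows that
    the difference quotients of [f] differ from [g] by O(h). *)
Lemma has_ps_D2 f z1 z2 c : has_ps f z1 z2 c -> has_ps (D2 f) z1 z2 (ps_d2 c).
Proof.
move=> [rho [M [r0 cM fE]]].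
have M0 : 0 <= M by rewrite (le_trans _ (cM 0 0)%N)// mulr_ge0// exprn_ge0// ltW.
have r20 : 0 < rho / 2 by rewrite divr_gt0.
(* Halving the radius absorbs the new factor j + 1 <= 2^j. *)
have dM i j : `|ps_d2 c i j| * (rho / 2) ^+ (i + j) <= M / rho.
  rewrite ler_pdivlMr// (le_trans _ (cM i j.+1))// /ps_d2 normrM normr_nat.
  rewrite addnS exprMn [X in _ <= _ * X]exprSr -!mulrA mulrCA ler_wpM2l//.
  rewrite mulrCA ler_wpM2l ?exprn_ge0 ?(ltW r0)// mulrA -[leRHS]mul1r.
  rewrite ler_pM2r// exprVn ler_pdivrMr ?exprn_gt0// mul1r.
  by rewrite (le_trans (ler_succ_exp2 _))// ler_weXn2l// ?leq_addl// ler1n.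
exists (rho / 2), (M / rho); split => // u v us vs.
(* As [s] is half of [rho / 16], the point [v + h] stays in the domain of the original expansion
   whenever [v] and [h] are below [s]. *)
set s := rho / 2 / 16 in us vs.
have sE : rho / 16 = s + s by rewrite /s; field.
have s0 : 0 < s by rewrite /s !divr_gt0.
have := ps_sum_cvg r20 dM (ltW us) (ltW vs).
set g := lim _ => gE; rewrite [D2 f _ _](_ : _ = g)//.
apply: (cvg_lim (@norm_hausdorff _ _)).
have s2 : s < rho / 16 by rewrite sE ltrDl.
have us2 := lt_trans us s2; have vs2 := lt_trans vs s2.
pose K := 2 * M / (rho / 16) ^+ 2.
have K0 : 0 <= K by rewrite mulr_ge0 ?mulr_ge0// invr_ge0 exprn_ge0// ltW// divr_gt0.
have hK h : `|h| < s ->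
   `|f (z1 + u) (z2 + (v + h)) - f (z1 + u) (z2 + v) - h * g| <= `|h| ^+ 2 * K.
  move=> hs; have vhs : `|v + h| < rho / 16.
    by rewrite (le_lt_trans (ler_normD _ _))// sE ltrD.
  have := fE _ _ us2 vhs; have := fE _ _ us2 vs2.
  rewrite -cvg_shiftS => f1; rewrite -cvg_shiftS => f2.
  have f3 : (fun N => ps_sum c N.+1 u (v + h) - ps_sum c N.+1 u v -
      h * ps_sum (ps_d2 c) N u v) @ \oo -->
      f (z1 + u) (z2 + (v + h)) - f (z1 + u) (z2 + v) - h * g.
    apply: cvgB; first exact: cvgB f2 f1.
    by apply: cvgM; first exact: cvg_cst.
  apply: (cvg_norm_le f3); near=> N.
  rewrite mulrA ler_pdivlMr ?exprn_gt0 ?divr_gt0//.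
  exact: (ps_sum_taylor _ r0 cM (ltW us2) (ltW vs2) (ltW vhs)).
apply/cvgrPdist_le => e e0.
(* [K] may be zero, so the division is by [K + 1]. *)
have K1 : 0 < K + 1 by rewrite ltr_wpDl.
near=> h.
have [h0 [hs he]] : h != 0 /\ `|h| < s /\ `|h| < e / (K + 1).
  near: h; apply: filterS2 (near_dnbhs0 s0) (near_dnbhs0 (divr_gt0 e0 K1)).
  by move=> h [? ?] [].
have hp : 0 < `|h| by rewrite normr_gt0.
rewrite -(ler_pM2l hp) -normrM mulrBr.
have -> : h * (h^-1 *: (f (z1 + u) (h + (z2 + v)) - f (z1 + u) (z2 + v))) =
    f (z1 + u) (z2 + (v + h)) - f (z1 + u) (z2 + v).
  by rewrite /GRing.scale/= mulVKf// [h + _]addrC addrA.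
rewrite distrC (le_trans (hK h hs))// expr2 -mulrA ler_wpM2l//.
apply: (@le_trans _ _ (`|h| * (K + 1))); first by rewrite ler_wpM2l// lerDl.
by rewrite -ler_pdivlMr// ltW.
Unshelve. all: by end_near. Qed.

Lemma ps_sum_swap c N u v :
  ps_sum (fun i j => c j i) N u v = ps_sum c N v u.
Proof.
apply: eq_bigr => k _; rewrite (reindex_inj rev_ord_inj) /=.
apply: eq_bigr => i _; rewrite /ps_term subSS subKn -1?ltnS//.
by rewrite -!mulrA [_ ^+ i * _]mulrC.
Qed.

Lemma has_ps_swap f z1 z2 c : has_ps f z1 z2 c ->
  has_ps (fun x y => f y x) z2 z1 (fun i j => c j i).
Proof.
move=> [rho [M [r0 cM fE]]]; exists rho, M; split => // [i j|u v us vs].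
  by rewrite addnC.
by under eq_fun do rewrite ps_sum_swap; exact: fE.
Qed.

Definition ps_d1 c : nat -> nat -> F := fun i j => (i.+1)%:R * c i.+1 j.

(** [D1] is [D2] conjugated by the exchange of the two variables. *)
Lemma has_ps_D1 f z1 z2 c : has_ps f z1 z2 c -> has_ps (D1 f) z1 z2 (ps_d1 c).
Proof.
by move=> /has_ps_swap /has_ps_D2 /has_ps_swap.
Qed.

Lemma has_ps_iterD f z1 z2 c i j : has_ps f z1 z2 c ->
  has_ps (iter i (@D1 F) (iter j (@D2 F) f)) z1 z2 (iter i ps_d1 (iter j ps_d2 c)).
Proof.
move=> fc; elim: i => [|i IHi]; last exact: has_ps_D1.
by elim: j => [//|j IHj]; exact: has_ps_D2.
Qed.

Lemma iter_ps_d2 c j a b : iter j ps_d2 c a b * b`!%:R = (b + j)`!%:R * c a (b + j)%N.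
Proof.
elim: j b => [|j IHj] b; first by rewrite addn0 mulrC.
rewrite iterS /ps_d2 mulrAC -natrM -factS mulrC IHj.
by rewrite addSnnS.
Qed.

Lemma iter_ps_d1 c i a b : iter i ps_d1 c a b * a`!%:R = (a + i)`!%:R * c (a + i)%N b.
Proof.
elim: i a => [|i IHi] a; first by rewrite addn0 mulrC.
rewrite iterS /ps_d1 mulrAC -natrM -factS mulrC IHi.
by rewrite addSnnS.
Qed.

(** Each partial derivative at the centre is the constant term of the differentiated series, hence
    i! j! times a coefficient of the original one. *)
Lemma pD_has_ps f z1 z2 c (p : bipoly F) : has_ps f z1 z2 c ->
  pD p f z1 z2 = \sum_(i < size p) \sum_(j < size p`_i)
    p`_i`_j * (i`!%:R * j`!%:R * c i j).
Proof.
move=> fc; apply: eq_bigr => i _; apply: eq_bigr => j _; congr (_ * _).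
rewrite (has_ps_center (has_ps_iterD i j fc)).
have := iter_ps_d1 (iter j ps_d2 c) i 0 0; have := iter_ps_d2 c j i 0.
by rewrite !fact0 !add0n !mulr1 => -> ->; rewrite mulrA.
Qed.

Lemma analytic_at_has_ps f z1 z2 : analytic_at f z1 z2 -> exists c, has_ps f z1 z2 c.
Proof.
move=> [c [r [r0 fc]]]; exists c.
have r20 : 0 < r / 2 by rewrite divr_gt0.
have r2r : `|r / 2| < r.
  by rewrite gtr0_norm// ltr_pdivrMr// ltr_pMr// ltr1n.
(* At the corner point with both offsets [r / 2] the sums of absolute values converge, so they are
   bounded; a bound on them bounds every single term, which is the coefficient estimate for radius
   [r / 2]. *)
have [] := fc (z1 + r / 2) (z2 + r / 2); rewrite ?[_ + r / 2 - _]addrC ?addKr//.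
move=> /cvg_seq_bounded/pinfty_ex_gt0[M M_gt0 /= cM] _.
exists (r / 2), M; split => // [i j|u v us vs].
  apply: le_trans (cM (i + j).+1 I).
  have s0 k : 0 <= \sum_(l < k.+1) `|ps_term c (r / 2) (r / 2) k l|.
    by rewrite sumr_ge0.
  rewrite [leRHS]ger0_norm; last by apply: sumr_ge0 => k _; exact: s0.
  rewrite big_ord_recr -[leLHS]add0r lerD//; first by apply: sumr_ge0 => k _; exact: s0.
  have ij : (i < (i + j).+1)%N by rewrite ltnS leq_addr.
  rewrite (bigD1 (Ordinal ij))//= -[leLHS]addr0 lerD ?sumr_ge0//.
  by rewrite /ps_term addKn !normrM !normrX (gtr0_norm r20) exprD mulrA.
have lr (w : F) : `|w| < r / 2 / 16 -> `|w| < r.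
  move=> /lt_le_trans; apply; rewrite -mulrA -invfM -natrM.
  by rewrite ler_pdivrMr// ler_pMr// ler1n.
have [] := fc (z1 + u) (z2 + v); rewrite ?[_ + u - _]addrC ?[_ + v - _]addrC ?addKr//.
- exact: lr.
- exact: lr.
Qed.

(** * The limit along the nodes *)

Lemma continuous_horner (p : {poly F}) : continuous (horner p).
Proof.
move=> x; elim/poly_ind: p => [|p b IHp].
  rewrite (_ : horner 0 = cst 0); first exact: cst_continuous.
  by apply/funext => h; rewrite horner0.
rewrite (_ : horner (p * 'X + b%:P) = (fun h => p.[h] * h + b)).
  have := @cvgD F F _ (nbhs x) _ (fun h => p.[h] * h) (cst b) (p.[x] * x) b.
  apply; last exact: (@cvg_cst F b).
  by apply: continuousM => //; exact: cvg_id.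
by apply/funext => h; rewrite hornerMXaddC.
Qed.

Lemma cvg_sumr (T I : Type) (G : set_system T) (FG : Filter G) (r : seq I)
    (g : I -> T -> F) (l : I -> F) : (forall i, g i @ G --> l i) ->
  (fun x => \sum_(i <- r) g i x) @ G --> \sum_(i <- r) l i.
Proof.
move=> gl; elim: r => [|i r IHr].
  rewrite big_nil (_ : (fun _ => _) = cst 0); first exact: (@cvg_cst F 0).
  by apply/funext => x; rewrite big_nil.
rewrite big_cons (_ : (fun _ => _) = fun x => g i x + \sum_(j <- r) g j x).
  exact: (@cvgD F F _ _ _ (g i)).
by apply/funext => x; rewrite big_cons.
Qed.

(** With offsets of size at most [C * |h|], the tail from degree m + 1 on is at most
    [K * |h| ^+ m.+1]; division by [h ^+ m] leaves a quantity of order h. *)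
Lemma ps_remainder f z1 z2 c m (u v : F -> F) (C : F) : has_ps f z1 z2 c -> 0 < C ->
  (\forall h \near 0^', `|u h| <= C * `|h| /\ `|v h| <= C * `|h|) ->
  (fun h => h ^- m * (f (z1 + u h) (z2 + v h) - ps_sum c m.+1 (u h) (v h)))
    @ 0^' --> (0 : F).
Proof.
move=> [rho [M [r0 cM fE]]] C0 uv.
have M0 : 0 <= M by rewrite (le_trans _ (cM 0 0)%N)// mulr_ge0// exprn_ge0// ltW.
pose K := 2 * M * (2 * (C / rho)) ^+ m.+1.
have K0 : 0 <= K.
  by rewrite mulr_ge0 ?mulr_ge0// exprn_ge0// mulr_ge0// ltW// divr_gt0.
have K1 : 0 < K + 1 by rewrite ltr_wpDl.
have d0 : 0 < rho / 16 / C by rewrite !divr_gt0.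
apply/cvgrPdist_le => e e0; near=> h.
have [h0 [hd he]] : h != 0 /\ `|h| < rho / 16 / C /\ `|h| < e / (K + 1).
  near: h; apply: filterS2 (near_dnbhs0 d0) (near_dnbhs0 (divr_gt0 e0 K1)).
  by move=> h [? ?] [].
have [us vs] : `|u h| <= C * `|h| /\ `|v h| <= C * `|h| by near: h.
rewrite sub0r normrN normrM normfV normrX.
have hp : 0 < `|h| by rewrite normr_gt0.
rewrite ler_pdivrMl ?exprn_gt0//.
have Cr : C * `|h| < rho / 16 by rewrite mulrC -ltr_pdivlMr.
have fc := fE _ _ (le_lt_trans us Cr) (le_lt_trans vs Cr).
have fc' : (fun N => ps_sum c N (u h) (v h) - ps_sum c m.+1 (u h) (v h)) @ \oo -->
    f (z1 + u h) (z2 + v h) - ps_sum c m.+1 (u h) (v h).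
  by apply: cvgB => //; exact: cvg_cst.
apply: (@le_trans _ _ (K * `|h| ^+ m.+1)).
  apply: (cvg_norm_le fc'); near=> N.
  apply: (le_trans (ps_tail_bound r0 cM (ltW Cr) us vs _)).
    by near: N; exact: nbhs_infty_ge.
  by rewrite /K -[leRHS]mulrA -exprMn -[_ * _ * `|h|]mulrA [C / rho * _]mulrAC.
rewrite exprSr mulrCA ler_wpM2l ?exprn_ge0//.
apply: (@le_trans _ _ ((K + 1) * `|h|)); first by rewrite ler_wpM2r// lerDl.
by rewrite mulrC -ler_pdivlMr// ltW.
Unshelve. all: by end_near. Qed.

Lemma node2_bound (a : nat -> F) (z : F) i : exists2 C, 0 < C &
  forall h, `|h| <= 1 -> `|znode2 a z i h - z| <= C * `|h|.
Proof.
exists (1 + \sum_(2 <= j < i.+1) (i ^_ j)%:R * `|a j|) => [|h h1].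
  by rewrite ltr_pwDl// sumr_ge0// => j _; rewrite mulr_ge0.
rewrite /znode2 [X in `|X|]addrC addKr (le_trans (ler_norm_sum _ _ _))//.
rewrite mulrDl mul1r -[leLHS]add0r lerD// mulr_suml big_nat [leRHS]big_nat.
apply: ler_sum => j /andP[j2 _]; rewrite !normrM normr_nat ler_wpM2l ?mulr_ge0//.
by rewrite normrX; case: j j2 => // j _; rewrite exprS ler_piMr// exprn_ile1.
Qed.

Lemma node_remainder (a : nat -> F) f z1 z2 c m i : has_ps f z1 z2 c ->
  (fun h => h ^- m * (f (znode1 z1 i h) (znode2 a z2 i h) -
     ps_sum c m.+1 (znode1 z1 i h - z1) (znode2 a z2 i h - z2))) @ 0^' --> (0 : F).
Proof.
move=> fc; have [C C0 vC] := node2_bound a z2 i.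
pose u h := znode1 z1 i h - z1; pose v h := znode2 a z2 i h - z2.
rewrite [X in X @ _](_ : _ = fun h =>
    h ^- m * (f (z1 + u h) (z2 + v h) - ps_sum c m.+1 (u h) (v h))); last first.
  by apply/funext => h; rewrite /u /v [z1 + _]addrC [z2 + _]addrC !subrK.
(* The first offset is [i%:R * h] and the second is bounded by [C * |h|] for small h; the sum of
   both constants serves for both. *)
apply: (@ps_remainder f z1 z2 c m u v (C + i%:R) fc); first by rewrite ltr_pwDl.
near=> h.
have h1 : `|h| <= 1 by near: h; exact: dnbhs0_le.
split; last by rewrite (le_trans (vC h h1))// ler_wpM2r// lerDl.
by rewrite /u /znode1 [X in `|X|]addrC addKr normrM normr_nat ler_wpM2r// lerDr ltW.
Unshelve. all: by end_near. Qed.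

(** Splitting [f] into its expansion up to degree m and a remainder, the first part gives exactly
    [Q.[h]] for h nonzero, which tends to [Q.[0]], and the second tends to 0. *)
Lemma Acoef_node_cvg (a : nat -> F) n f z1 z2 c m : (m <= n)%N -> has_ps f z1 z2 c ->
  (fun h => h ^- m * \sum_(i < m.+1)
     Acoef F m i * f (znode1 z1 i h) (znode2 a z2 i h)) @ 0^' -->
  \sum_(k < m.+1) \sum_(i < k.+1)
     c i (k - i)%N * ('X^i * shift_poly a n ^+ (k - i))`_m.
Proof.
move=> mn fc; have [Q [<- Qh]] := Acoef_sum_ps a c z1 z2 mn.
rewrite -[Q.[0]]add0r.
have Q0 : (fun h => Q.[h]) @ 0^' --> Q.[0].
  by apply: cvg_trans (@continuous_horner Q 0); apply: cvg_app; exact: cvg_within.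
pose g i h := Acoef F m i * (h ^- m * (f (znode1 z1 i h) (znode2 a z2 i h) -
  ps_sum c m.+1 (znode1 z1 i h - z1) (znode2 a z2 i h - z2))).
have g0 (i : 'I_m.+1) : g i @ 0^' --> (0 : F).
  rewrite -[X in _ --> X](mulr0 (Acoef F m i)); apply: cvgM; first exact: cvg_cst.
  exact: node_remainder.
have R0 : (fun h => \sum_(i < m.+1) g i h) @ 0^' --> (0 : F).
  have := @cvg_sumr _ _ _ (dnbhs_filter (0 : F)) (index_enum 'I_m.+1) _ _ g0.
  by rewrite big1; first apply.
apply: cvg_trans (cvgD R0 Q0); apply: near_eq_cvg; near=> h => /=.
have h0 : h != 0 by near: h; exact: nbhs_dnbhs_neq.
apply: (@etrans _ _ (\sum_(i < m.+1) g i h + Q.[h])) => //.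
rewrite -[Q.[h]](mulKf (expf_neq0 m h0)) -Qh !mulr_sumr -big_split /=.
by apply: eq_bigr => i _; rewrite /g; ring.
Unshelve. all: by end_near. Qed.

(** * Regrouping by total degree and conclusion over a general field *)

Lemma sum_triangle m (G : nat -> nat -> F) :
  \sum_(k < m.+1) \sum_(i < k.+1) G i (k - i)%N =
  \sum_(i < m.+1) \sum_(j < m.+1 | (i + j <= m)%N) G i j.
Proof.
elim: m => [|m IHm].
  by rewrite !big_ord1 big_mkcond big_ord1.
rewrite big_ord_recr /= {}IHm.
(* Passing from m to m + 1 adds to row i exactly the entry on the new antidiagonal. *)
rewrite [RHS](eq_bigr (fun i : 'I_m.+2 =>
  \sum_(j < m.+1 | (i + j <= m)%N) G i j + G i (m.+1 - i)%N)).
  rewrite big_split /=; congr (_ + _).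
  by rewrite [RHS]big_ord_recr /= [X in _ = _ + X]big1 ?addr0// => j; lia.
move=> i _; have im : (m.+1 - i < m.+2)%N by lia.
rewrite (bigD1 (Ordinal im)) /=; last by have := ltn_ord i; lia.
rewrite addrC; congr (_ + _).
rewrite [LHS]big_mkcond [LHS]big_ord_recr /= -[RHS]addr0; congr (_ + _); last first.
  by case: ifP => //; rewrite -val_eqE /=; have := ltn_ord i; lia.
rewrite [RHS]big_mkcond; apply: eq_bigr => j _; rewrite -val_eqE /=.
have := ltn_ord i; have := ltn_ord j => jm {}im.
by congr (if _ then _ else _); lia.
Qed.

Lemma bipoly_sum m (p : bipoly F) (G : nat -> nat -> F) :
  (forall i j, (m < i + j)%N -> p`_i`_j = 0) ->
  \sum_(i < size p) \sum_(j < size p`_i) p`_i`_j * G i j =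
  \sum_(k < m.+1) \sum_(i < k.+1) p`_i`_(k - i) * G i (k - i)%N.
Proof.
move=> p0; rewrite (sum_triangle m (fun i j => p`_i`_j * G i j)).
have sp : (size p <= m.+1)%N.
  apply/leq_sizeP => i im; apply/polyP => j; rewrite coef0 p0//.
  by rewrite (leq_trans im)// leq_addr.
have spi i : (size (p`_i)%R <= m.+1)%N.
  apply/leq_sizeP => j jm; rewrite p0//.
  by rewrite (leq_trans jm)// leq_addl.
rewrite (big_ord_widen _ (fun i => \sum_(j < size p`_i) p`_i`_j * G i j) sp).
rewrite big_mkcond; apply: eq_bigr => i _; case: ltnP => ip; last first.
  by rewrite big1// => j _; rewrite (nth_default 0 ip) coef0 mul0r.
rewrite (big_ord_widen _ (fun j => p`_i`_j * G i j) (spi i)).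
rewrite big_mkcond [RHS]big_mkcond; apply: eq_bigr => j _.
case: ltnP => jp; case: leqP => ij //; first by rewrite p0 ?mul0r.
by rewrite nth_default ?mul0r.
Qed.

Lemma coef_exp_lt (p : {poly F}) j k : p`_0 = 0 -> (k < j)%N -> (p ^+ j)`_k = 0.
Proof.
move=> p0; elim: j k => // j IHj k kj; rewrite exprS coefM big1// => -[[|t] tk] _ /=.
  by rewrite p0 mul0r.
by rewrite IHj ?mulr0//; lia.
Qed.

(** The factor i! j! from differentiating [f] cancels the denominator in [coef_L], so [pD (L m) f]
    at the centre is the limit found in [Acoef_node_cvg]. *)
Lemma nodes_cvg n (a : nat -> F) (L : nat -> bipoly F) :
  L 0%N = 1 -> L 1%N = bx1 F ->
  (forall k, (2 <= k <= n)%N ->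
     L k = Psi1 (L k.-1)
           + Psi2 (restr0 (\sum_(2 <= t < k) bcst (a t) * L (k - t)%N))
           + bcst (a k) * bx2 F) ->
  forall (z1 z2 : F) (f : F -> F -> F), analytic_at f z1 z2 ->
  forall m, (m <= n)%N ->
    (fun h => h ^- m * \sum_(i < m.+1)
                 Acoef F m i * f (znode1 z1 i h) (znode2 a z2 i h))
      @ 0^' --> pD (L m) f z1 z2.
Proof.
move=> L0 L1 Lk z1 z2 f /analytic_at_has_ps[c fc] m mn.
have LE i j := coef_L L0 L1 Lk i j mn.
have a0 : (shift_poly a n)`_0 = 0 by rewrite coef_shift_poly.
rewrite (pD_has_ps _ fc) (@bipoly_sum m _ (fun i j => i`!%:R * j`!%:R * c i j)).
  rewrite (_ : \sum_(k < _) _ = \sum_(k < m.+1) \sum_(i < k.+1)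
     c i (k - i)%N * ('X^i * shift_poly a n ^+ (k - i))`_m).
    exact: Acoef_node_cvg.
  apply: eq_bigr => k _; apply: eq_bigr => i _.
  rewrite LE mulrA mulfVK 1?mulrC// mulf_neq0// pnatr_eq0 -lt0n fact_gt0//.
(* A(t) has no constant term, so t^i A(t)^j is divisible by t^(i+j); hence [L m] has total degree at
   most m. *)
move=> i j mij; rewrite LE coefXnM; case: ltnP => im; rewrite ?mul0r//.
by rewrite coef_exp_lt ?mul0r//; lia.
Qed.
End Analysis.

(** * Completeness of R and R[i] *)

Lemma geom_complete_real (R : realType) : geom_complete R.
Proof.
move=> t M tM.
have M0 : 0 <= M by have := tM 0%N; rewrite expr0 mulr1; exact: le_trans.
have tc : cvg ([normed series t] @ \oo).
  apply: (@series_le_cvg _ _ (geometric M 2^-1)) => [k|k|k|].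
  - exact: normr_ge0.
  - by rewrite /= mulr_ge0// exprn_ge0// invr_ge0.
  - exact: tM.
  - by apply: is_cvg_geometric_series; rewrite ger0_norm// invf_lt1// ltr1n.
have := normed_cvg tc; rewrite (_ : series t = fun N => \sum_(k < N) t k)//.
by apply/funext => N; rewrite /series/= big_mkord.
Qed.

Lemma normc_real (R : rcfType) (x : R) : `|x%:C%C| = `|x|%:C%C :> R[i].
Proof. by rewrite normc_def /= expr0n addr0 sqrtr_sqr. Qed.

Lemma normc_ge_Im (R : rcfType) (z : R[i]) : `|complex.Im z|%:C%C <= `|z|.
Proof. by rewrite normc_def lecR -sqrtr_sqr ler_wsqrtr// lerDr sqr_ge0. Qed.

Lemma normc_le_ReIm (R : rcfType) (z : R[i]) :
  `|z| <= (`|complex.Re z| + `|complex.Im z|)%:C%C.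
Proof.
rewrite [in leLHS](complexE z) rmorphD/= (le_trans (ler_normD _ _))//.
rewrite normrM !normc_real lerD// ler_piMl//; first by rewrite lecR.
by rewrite normc_def /= expr0n add0r expr1n sqrtr1.
Qed.

(** Real and imaginary parts are dominated by the same geometric sequence, so the real case applies
    to each. *)
Lemma geom_complete_complex (R : realType) : geom_complete R[i].
Proof.
move=> t M tM.
have M0 : 0 <= M by have := tM 0%N; rewrite expr0 mulr1; exact: le_trans.
(* A nonnegative element of [R[i]] has zero imaginary part, so the bound is real. *)
have ME k : M * 2^-1 ^+ k = (complex.Re M * 2^-1 ^+ k)%:C%C.
  rewrite rmorphM rmorphXn fmorphV rmorph_nat /=; congr (_ * _).
  by case: M M0 {tM} => a b; rewrite lecE /= => /andP[/eqP -> _].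
have bRe k : `|complex.Re (t k)| <= complex.Re M * 2^-1 ^+ k.
  by rewrite -lecR -ME (le_trans (normc_ge_Re _)).
have /cvg_ex[p pE] := geom_complete_real bRe.
have bIm k : `|complex.Im (t k)| <= complex.Re M * 2^-1 ^+ k.
  by rewrite -lecR -ME (le_trans (normc_ge_Im _)).
have /cvg_ex[q qE] := geom_complete_real bIm.
pose l : (R[i] : numFieldType) := Complex p q.
suff /cvgrPdist_lt h : forall e : R[i], 0 < e ->
    \forall N \near \oo, `|l - \sum_(k < N) t k| < e.
  by apply/cvg_ex; exists l.
move=> [e e'] /=; rewrite ltcE /= => /andP[/eqP -> e0].
have e20 : 0 < e / 2 by rewrite divr_gt0.
near=> N.
have sE : \sum_(k < N) t k =
    Complex (\sum_(k < N) complex.Re (t k)) (\sum_(k < N) complex.Im (t k)).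
  elim: (N) => [|n IHn]; first by rewrite !big_ord0.
  by rewrite !big_ord_recr /= IHn; case: (t n).
rewrite sE (le_lt_trans (normc_le_ReIm _))// ltcR (splitr e) ltrD//=.
- by near: N; exact: cvgr_dist_lt.
- by near: N; exact: cvgr_dist_lt.
Unshelve. all: by end_near. Qed.

Theorem theorem11 (R : realType) :
  (forall (n : nat) (a : nat -> R) (L : nat -> bipoly R),
    (1 <= n)%N ->
    L 0%N = 1 -> L 1%N = bx1 R ->
    (forall k, (2 <= k <= n)%N ->
       L k = Psi1 (L k.-1)
             + Psi2 (restr0 (\sum_(2 <= t < k) bcst (a t) * L (k - t)%N))
             + bcst (a k) * bx2 R) ->
    forall (z01 z02 : R) (f : R -> R -> R), analytic_at f z01 z02 ->
    forall m, (m <= n)%N ->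
      (fun h => h ^- m * \sum_(i < m.+1)
                   Acoef R m i * f (znode1 z01 i h) (znode2 a z02 i h))
        @ 0^' --> pD (L m) f z01 z02)
  /\
  (forall (n : nat) (a : nat -> R[i]) (L : nat -> bipoly R[i]),
    (1 <= n)%N ->
    L 0%N = 1 -> L 1%N = bx1 R[i] ->
    (forall k, (2 <= k <= n)%N ->
       L k = Psi1 (L k.-1)
             + Psi2 (restr0 (\sum_(2 <= t < k) bcst (a t) * L (k - t)%N))
             + bcst (a k) * bx2 R[i]) ->
    forall (z01 z02 : R[i]) (f : R[i] -> R[i] -> R[i]), analytic_at f z01 z02 ->
    forall m, (m <= n)%N ->
      (fun h => h ^- m * \sum_(i < m.+1)
                   Acoef R[i] m i * f (znode1 z01 i h) (znode2 a z02 i h))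
        @ 0^' --> pD (L m) f z01 z02).
Proof.
split=> n a L _; apply: nodes_cvg.
- exact: geom_complete_real.
- exact: geom_complete_complex.
Qed.
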